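(* Let $p$ be a prime, let $\mathcal F$ be a saturated fusion system on a finite $p$-group $S$, and let $P$ be a strongly $\mathcal F$-closed subgroup of $S$. Then $P\unlhd\mathcal F$ if and only if there is no $\mathcal F$-essential subgroup with respect to $P$.
   Context: All groups are finite and maps are written on the right. Fusion systems and saturated fusion systems on finite $p$-groups are understood in the standard sense. $P\unlhd\mathcal F$ means $\mathcal F=N_{\mathcal F}(P)$, i.e. $P\unlhd S$ and every morphism $\phi:A\to B$ in $\mathcal F$ extends to a morphism $\overline\phi: PA\to PB$ in $\mathcal F$ with $P\overline\phi=P$. A subgroup $P\le S$ is strongly $\mathcal F$-closed if for all $x\in P$ and all $\phi\in\mathrm{Hom}_{\mathcal F}(\langle x\rangle,S)$ one has $x\phi\in P$. A subgroup $Q\leq S$ is fully ($\mathcal F$-)normalized if $|N_S(Q)|\ge |N_S(R)|$ for every $\mathcal F$-conjugate $R$ of $Q$. For $D\le T\le G$, $D$ is strongly closed in $T$ with respect to $G$ if $x^g\in D$ whenever $x\in D$, $g\in G$ and $x^g\in T$. Strongly $D$-embedded: let $G$ be a group, $T\in \mathrm{Syl}_p(G)$, and $D>1$ a strongly closed subgroup in $T$ with respect to $G$. A proper subgroup $H<G$ is strongly $D$-embedded in $G$ if (i) $D^x\le H$ for some $x\in G$; and (ii) for all $g\in G\setminus H$, the subgroup $H\cap H^g$ does not contain any $G$-conjugate of any nontrivial subgroup $U$ of $D$. Let $P$ be strongly $\mathcal F$-closed in $S$. A subgroup $Q\le P$ is $\mathcal F$-centric with respect to $P$ if $C_P(Q\psi)\le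 Q\psi$ for all $\psi\in\mathrm{Hom}_{\mathcal F}(Q,P)$. A proper subgroup $Q<P$ is an $\mathcal F$-essential subgroup with respect to $P$ if (i) $Q$ is $\mathcal F$-centric with respect to $P$; (ii) $Q$ is fully $\mathcal F$-normalized; (iii) $\mathrm{Out}_{\mathcal F}(Q)=\mathrm{Aut}_{\mathcal F}(Q)/\mathrm{Inn}(Q)$ has a strongly $\mathrm{Out}_P(Q)$-embedded subgroup, where $\mathrm{Out}_P(Q)=\mathrm{Aut}_P(Q)/\mathrm{Inn}(Q)$ and $\mathrm{Aut}_P(Q)$ is the group of automorphisms of $Q$ induced by conjugation by elements of $N_P(Q)$. (For $Q$ fully $\mathcal F$-normalized, $\mathrm{Out}_P(Q)$ is strongly closed in the Sylow $p$-subgroup $\mathrm{Out}_S(Q)$ of $\mathrm{Out}_{\mathcal F}(Q)$ with respect to $\mathrm{Out}_{\mathcal F}(Q)$, so this makes sense.) *)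

(* Defs.v *)
From HB Require Import structures.
From mathcomp Require Import all_boot all_fingroup all_solvable.

Set Implicit Arguments.
Unset Strict Implicit.
Unset Printing Implicit Defensive.

Import GroupScope.

(* A map between subgroups is given by a function gT -> gT of which only the
   values on the source matter (hom_ext).  Objects are the subgroups of S, so
   hom A B is empty unless A, B <= S (hom_inj).  Maps act on the right: the
   composite "f, then g" is g \o f, and x ^ g = g^-1 * x * g.
   hom_conj contains the identities and inclusions (take g = 1); hom_factor
   says that every morphism is an isomorphism of the category followed by an
   inclusion. *)
Record fusion_system (gT : finGroupType) (S : {group gT}) := FusionSystem {
  hom : {group gT} -> {group gT} -> pred (gT -> gT);
  hom_ext : forall (A B : {group gT}) (f g : gT -> gT),
    {in A, f =1 g} -> hom A B f -> hom A B g;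
  hom_inj : forall (A B : {group gT}) (f : gT -> gT), hom A B f ->
    [/\ A \subset S, B \subset S, morphic A f, {in A &, injective f}
      & f @: A \subset B];
  hom_conj : forall (A B : {group gT}) (g : gT),
    A \subset S -> B \subset S -> g \in S -> A :^ g \subset B ->
    hom A B (conjg^~ g);
  hom_comp : forall (A B C : {group gT}) (f g : gT -> gT),
    hom A B f -> hom B C g -> hom A C (g \o f);
  hom_factor : forall (A B : {group gT}) (f : gT -> gT), hom A B f ->
    exists (C : {group gT}) (h : gT -> gT),
      [/\ C \subset B, hom A C f, hom C A h, {in A, cancel f h}
        & {in C, cancel h f}]
}.

Section Fusion.

Variables (gT : finGroupType) (S : {group gT}) (F : fusion_system S).
Implicit Types (A B P Q R : {group gT}) (f : gT -> gT).

Definition fs_iso A B f : Prop :=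
  hom F A B f /\
  exists h, [/\ hom F B A h, {in A, cancel f h} & {in B, cancel h f}].

Definition fs_conjugate Q R : Prop := exists f, fs_iso Q R f.

Definition fully_normalized Q : Prop :=
  Q \subset S /\ forall R, fs_conjugate Q R -> #|'N_S(R)| <= #|'N_S(Q)|.

Definition fully_centralized Q : Prop :=
  Q \subset S /\ forall R, fs_conjugate Q R -> #|'C_S(R)| <= #|'C_S(Q)|.

(* The guard Q \subset S only serves to make this a group for every Q; the set
   is meaningful, and is Aut_F(Q), for Q <= S. *)
Definition AutF Q : {set {perm gT}} :=
  [set a in Aut Q | (Q \subset S) ==> hom F Q Q a].

Lemma AutF_group_set Q : group_set (AutF Q).
Proof.
apply/group_setP; split.
  rewrite inE group1; apply/implyP => sQS.
  apply: hom_ext (hom_conj F sQS sQS (group1 S) _).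
    by move=> x _; rewrite /= perm1 conjg1.
  by rewrite conjsg1.
move=> a b /setIdP[Aa /implyP Fa] /setIdP[Ab /implyP Fb].
apply/setIdP; split; first exact: groupM.
apply/implyP => sQS; apply: hom_ext (hom_comp (Fa sQS) (Fb sQS)).
by move=> x _; rewrite permM.
Qed.

Canonical AutF_group Q := Group (AutF_group_set Q).

Definition Aut_by P Q : {set {perm gT}} := conj_aut Q @* 'N_P(Q).

Canonical Aut_by_group P Q := [group of Aut_by P Q].

Definition Inn Q : {set {perm gT}} := conj_aut Q @* Q.

Canonical Inn_group Q := [group of Inn Q].

(* N_f = { g in N_S(Q) | f^-1 c_g f lies in Aut_S(Qf) }: the condition says
   that f^-1 c_g f is conjugation by some h in N_S(Qf). *)
Definition Nphi Q f : {set gT} :=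
  [set g in 'N_S(Q) |
    [exists h in 'N_S(f @: Q), [forall x in Q, f (x ^ g) == f x ^ h]]].

Lemma Nphi_group_set Q f : group_set (Nphi Q f).
Proof.
apply/group_setP; split.
  rewrite inE group1; apply/exists_inP; exists 1; first exact: group1.
  by apply/forall_inP => x _; rewrite !conjg1.
move=> g k /setIdP[Ng /exists_inP[h Nh /forall_inP fg]].
case/setIdP=> Nk /exists_inP[l Nl /forall_inP fk].
apply/setIdP; split; first exact: groupM.
apply/exists_inP; exists (h * l); first exact: groupM.
apply/forall_inP => x Qx; rewrite !conjgM -(eqP (fg x Qx)) fk //.
by rewrite memJ_norm //; case/setIP: Ng.
Qed.

Canonical Nphi_group Q f := Group (Nphi_group_set Q f).

Definition saturated (p : nat) : Prop :=
  (forall Q, fully_normalized Q ->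
     fully_centralized Q /\ p.-Sylow(AutF Q) (Aut_by S Q)) /\
  (forall Q R f, hom F Q S f -> f @: Q = R -> fully_centralized R ->
     exists f', hom F (Nphi_group Q f) S f' /\ {in Q, f' =1 f}).

Definition strongly_closed P : Prop :=
  P \subset S /\
  forall x f, x \in P -> hom F <[x]>%G S f -> f x \in P.

Definition fs_normal P : Prop :=
  P <| S /\
  forall A B f, hom F A B f ->
    exists f', [/\ hom F (P <*> A)%G (P <*> B)%G f', {in A, f' =1 f}
                 & f' @: P = P].

Definition centric_wrt P Q : Prop :=
  Q \subset P /\ forall f, hom F Q P f -> 'C_P(f @: Q) \subset f @: Q.

End Fusion.

Section StronglyEmbedded.

Variable gT : finGroupType.
Implicit Types (D T G H : {group gT}).

Definition strongly_closed_in D T G : Prop :=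
  [/\ D \subset T, T \subset G
    & forall x g, x \in D -> g \in G -> x ^ g \in T -> x ^ g \in D].

Definition strongly_embedded (p : nat) T D G H : Prop :=
  [/\ [/\ p.-Sylow(G) T, D :!=: 1 & strongly_closed_in D T G],
      H \proper G,
      exists2 x, x \in G & D :^ x \subset H
    & forall g, g \in G :\: H -> forall (U : {group gT}) x,
        U \subset D -> U :!=: 1 -> x \in G ->
        ~~ (U :^ x \subset H :&: H :^ g)].

End StronglyEmbedded.

Section Essential.

Variables (gT : finGroupType) (S : {group gT}) (F : fusion_system S).

Definition OutF (Q : {group gT}) : {group coset_of (Inn Q)} :=
  (AutF F Q / Inn Q)%G.

Definition Out_by (P Q : {group gT}) : {group coset_of (Inn Q)} :=
  (Aut_by P Q / Inn Q)%G.

Definition essential_wrt (p : nat) (P Q : {group gT}) : Prop :=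
  [/\ Q \proper P, centric_wrt F P Q, fully_normalized F Q
    & exists H, strongly_embedded p (Out_by S Q) (Out_by P Q) (OutF Q) H].

End Essential.

(* Main.v *)
Require Import Defs.
From mathcomp Require Import all_boot all_fingroup all_solvable.

(** If P is normal in F, then Aut_P(Q) is normal in Aut_F(Q) for every Q < P,
    so a strongly Out_P(Q)-embedded subgroup would contain the nontrivial
    Out_P(Q) together with all its conjugates, which is absurd.

    Conversely, by an Alperin-type induction it suffices to extend to PR every
    automorphism a of a fully normalized R not containing P, and by induction
    this is possible as soon as N_a meets P outside R.  For R < P, this
    condition holds if C_P(R) is not in R; otherwise R is centric with respect
    to P, and if the automorphisms that extend form a proper subgroup of
    Aut_F(R), then its image in Out_F(R) is strongly Out_P(R)-embedded.  Hence,
    if no subgroup is essential, morphisms between subgroups of P extend to P.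
    For arbitrary R, the automorphisms of R in F that act trivially on
    R/(R cap P) and on R cap P as elements of P then form a normal p-subgroup
    of Aut_F(R).  It lies in Aut_S(R) and contains Aut_P(R), so that N_a
    contains N_P(R). *)

Import GroupScope.

Set Implicit Arguments.
Unset Strict Implicit.
Unset Printing Implicit Defensive.

(** * Morphisms, restrictions and isomorphisms *)

Section FusionSystems.

Variables (gT : finGroupType) (S : {group gT}) (F : fusion_system S).
Implicit Types (A B C D P Q R U : {group gT}) (f g h : gT -> gT).
Implicit Types (a b : {perm gT}) (u v x y : gT).

Lemma hom_morph {A B f} :
  hom F A B f -> {in A &, forall x y, f (x * y) = f x * f y}.
Proof. by case/hom_inj=> _ _ /morphicP. Qed.

Lemma hom_injective {A B f} : hom F A B f -> {in A &, injective f}.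
Proof. by case/hom_inj. Qed.

Lemma hom_mem {A B f x} : hom F A B f -> x \in A -> f x \in B.
Proof.
by case/hom_inj=> _ _ _ _ /subsetP fAB Ax; rewrite fAB ?imset_f.
Qed.

Lemma hom_dom {A B f} : hom F A B f -> A \subset S.
Proof. by case/hom_inj. Qed.

Lemma hom_cod {A B f} : hom F A B f -> B \subset S.
Proof. by case/hom_inj. Qed.

Lemma hom_conjg {A B f} : hom F A B f ->
  {in A &, forall x y, f (x ^ y) = f x ^ f y}.
Proof.
move=> Ff x y Ax Ay; apply: (mulgI (f y)).
by rewrite -(hom_morph Ff) ?groupJ // -!conjgC (hom_morph Ff).
Qed.

Lemma homV {A B f} : hom F A B f -> {in A, {morph f : x / x^-1}}.
Proof.
move=> Ff x Ax; apply: (mulgI (f x)).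
have f1 : f 1 = 1 by apply: (mulgI (f 1)); rewrite -(hom_morph Ff) ?mulg1.
by rewrite -(hom_morph Ff) ?groupV // !mulgV f1.
Qed.

Lemma hom_incl A B : A \subset B -> B \subset S -> hom F A B id.
Proof.
move=> sAB sBS; have sAS := subset_trans sAB sBS.
apply: hom_ext (hom_conj F sAS sBS (group1 S) _); last by rewrite conjsg1.
by move=> x _; rewrite /= conjg1.
Qed.

Lemma hom_image {A B f} :
  hom F A B f ->
  exists2 C : {group gT}, C = f @: A :> {set gT} & fs_iso F A C f.
Proof.
move=> Ff; have [C [h [sCB Ff' Fh fK hK]]] := hom_factor Ff.
exists C; last by split=> //; exists h.
apply/eqP; rewrite eqEsubset; apply/andP; split; apply/subsetP=> x.
  by move=> Cx; rewrite -(hK x Cx) imset_f // (hom_mem Fh).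
by case/imsetP=> y Ay ->; apply: hom_mem Ff' Ay.
Qed.

(** Restriction of the source is composition with an inclusion; the target is cut down by passing
    through the image, onto which [f] is an isomorphism by [hom_factor]. *)
Lemma hom_sub {A B f} A' B' : hom F A B f ->
    A' \subset A -> B' \subset S -> {in A', forall x, f x \in B'} ->
  hom F A' B' f.
Proof.
move=> Ff sA' sB'S fA'.
have Ff' : hom F A' B f.
  by have := hom_comp (hom_incl sA' (hom_dom Ff)) Ff.
have [C defC [FfC _]] := hom_image Ff'.
suff sCB' : C \subset B' by have := hom_comp FfC (hom_incl sCB' sB'S).
by rewrite defC; apply/subsetP=> _ /imsetP[x A'x ->]; apply: fA'.
Qed.

Lemma hom_widen {A B f} : hom F A B f -> hom F A S f.
Proof.
move=> Ff; apply: (hom_sub Ff) => // x Ax.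
by rewrite (subsetP (hom_cod Ff)) // (hom_mem Ff).
Qed.

Lemma fs_iso_im {A B f} : fs_iso F A B f -> f @: A = B.
Proof.
case=> Ff [h [Fh fK hK]]; apply/eqP; rewrite eqEsubset; apply/andP; split.
  by apply/subsetP=> _ /imsetP[x Ax ->]; apply: hom_mem Ff Ax.
by apply/subsetP=> x Bx; rewrite -(hK x Bx) imset_f // (hom_mem Fh).
Qed.

Lemma fs_iso_of_im {A B f} : hom F A S f -> f @: A = B -> fs_iso F A B f.
Proof.
move=> Ff fAB; have [C defC FC] := hom_image Ff.
by have -> : B = C by apply/val_inj; rewrite /= defC.
Qed.

Lemma fs_iso_inv {A B f} : fs_iso F A B f ->
  exists h, [/\ fs_iso F B A h, {in A, cancel f h} & {in B, cancel h f}].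
Proof.
by case=> Ff [h [Fh fK hK]]; exists h; split=> //; split=> //; exists f.
Qed.

Lemma fs_iso_comp {A B C f g} :
  fs_iso F A B f -> fs_iso F B C g -> fs_iso F A C (g \o f).
Proof.
case=> Ff [f' [Ff' fK f'K]] [Fg [g' [Fg' gK g'K]]]; split.
  exact: hom_comp Ff Fg.
exists (f' \o g'); split; first exact: hom_comp Fg' Ff'.
  by move=> x Ax; rewrite /= gK ?fK // (hom_mem Ff).
by move=> x Cx; rewrite /= f'K ?g'K // (hom_mem Fg').
Qed.

Lemma fs_iso_refl A : A \subset S -> fs_iso F A A id.
Proof. by move=> sAS; split; [|exists id; split=> //]; apply: hom_incl. Qed.

(** * Automorphism groups and automorphisms induced by conjugation *)

Lemma AutF_hom {Q a} : Q \subset S -> a \in AutF F Q -> hom F Q Q a.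
Proof. by move=> sQS /setIdP[_ /implyP->]. Qed.

Lemma AutF_homS {Q a} : Q \subset S -> a \in AutF F Q -> hom F Q S a.
Proof. by move=> sQS /(AutF_hom sQS)/hom_widen. Qed.

Lemma AutF_sub_Aut {Q} : AutF F Q \subset Aut Q.
Proof. by apply/subsetP=> a /setIdP[]. Qed.

Lemma AutF_Aut {Q a} : a \in AutF F Q -> a \in Aut Q.
Proof. exact: (subsetP AutF_sub_Aut). Qed.

Lemma AutF_im {Q a} : a \in AutF F Q -> a @: Q = Q.
Proof. by case/setIdP=> /setIdP[/im_perm_on]. Qed.

Lemma AutF_iso {Q a} : Q \subset S -> a \in AutF F Q -> fs_iso F Q Q a.
Proof. by move=> sQS AFa; apply: fs_iso_of_im (AutF_homS _ _) (AutF_im _). Qed.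

Lemma hom_AutF {Q f} : hom F Q Q f ->
  exists2 a, a \in AutF F Q & {in Q, a =1 f}.
Proof.
move=> Ff; case: (hom_inj Ff) => sQS _ /morphicP fM injf fQ.
exists (perm_in injf fQ); last exact: perm_inE.
rewrite !inE perm_in_on /= sQS /=; apply/andP; split.
  by apply/morphicP=> x y Qx Qy; rewrite !perm_inE ?groupM ?fM.
by apply: hom_ext Ff => x Qx; rewrite perm_inE.
Qed.

Lemma conj_aut_AutF {Q u} :
  Q \subset S -> u \in 'N_S(Q) -> conj_aut Q u \in AutF F Q.
Proof.
move=> sQS /setIP[Su Nu]; rewrite inE; apply/andP; split.
  by rewrite (subsetP (Aut_conj_aut Q 'N(Q))) // mem_morphim.
apply/implyP=> _; apply: hom_ext (hom_conj F sQS sQS Su _).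
  by move=> x Qx; rewrite norm_conj_autE.
by rewrite (normP Nu).
Qed.

Lemma Aut_byP {P Q a} :
  reflect (exists2 u, u \in 'N_P(Q) & a = conj_aut Q u) (a \in Aut_by P Q).
Proof.
apply: (iffP morphimP) => [[u _ Nu ->] | [u Nu ->]]; first by exists u.
by exists u => //; case/setIP: Nu.
Qed.

Lemma Aut_byS {P R Q} : P \subset R -> Aut_by P Q \subset Aut_by R Q.
Proof. by move=> sPR; rewrite morphimS ?setSI. Qed.

Lemma Inn_sub_Aut_by P Q : Q \subset P -> Inn Q \subset Aut_by P Q.
Proof. by move=> sQP; rewrite morphimS // subsetI sQP normG. Qed.

Lemma Aut_by_sub_AutF Q : Q \subset S -> Aut_by S Q \subset AutF F Q.
Proof.
by move=> sQS; apply/subsetP=> _ /Aut_byP[u Nu ->]; apply: conj_aut_AutF.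
Qed.

Lemma conj_autJ {Q u a} : u \in 'N(Q) ->
  {in Q, forall x, (conj_aut Q u ^ a) (a x) = a (x ^ u)}.
Proof. by move=> Nu x Qx; rewrite permJ norm_conj_autE. Qed.

Lemma conj_aut_Aut {Q u} : u \in 'N(Q) -> conj_aut Q u \in Aut Q.
Proof.
by move=> Nu; rewrite (subsetP (Aut_conj_aut Q 'N(Q))) // mem_morphim.
Qed.

(** On Q one has a(x)^f(u) = f(x^u) = a(x^u). So an extension of [a] that is defined at [u] shows
    which element induces the conjugate under [a] of conjugation by [u]. *)
Lemma conj_aut_extension {Q B C a f u} : a \in AutF F Q -> hom F B C f ->
    Q \subset B -> {in Q, f =1 a} -> u \in B -> u \in 'N(Q) ->
  f u \in 'N(Q) /\ conj_aut Q u ^ a = conj_aut Q (f u).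
Proof.
move=> AFa Ff sQB fE Bu Nu; have Aa := AutF_Aut AFa.
have fuE : {in Q, forall x, a x ^ f u = a (x ^ u)}.
  move=> x Qx; have Bx := subsetP sQB x Qx.
  by rewrite -!fE ?memJ_norm // (hom_conjg Ff).
have Nfu : f u \in 'N(Q).
  rewrite inE -{1}(AutF_im AFa).
  apply/subsetP=> _ /imsetP[_ /imsetP[x Qx ->] ->].
  by rewrite fuE // Aut_closed ?memJ_norm.
split=> //; apply: (@eq_Aut _ Q); rewrite ?groupJ ?conj_aut_Aut // => x.
rewrite -{1}(AutF_im AFa) => /imsetP[y Qy ->].
by rewrite (conj_autJ Nu Qy) norm_conj_autE ?fuE // Aut_closed.
Qed.

Lemma Inn_norm_AutF Q : Q \subset S -> AutF F Q \subset 'N(Inn Q).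
Proof.
move=> sQS; apply/subsetP=> a AFa; rewrite inE.
apply/subsetP=> _ /imsetP[_ /morphimP[u Nu Qu ->] ->].
have Fa := AutF_hom sQS AFa.
have [//|Nau ->] := conj_aut_extension AFa Fa (subxx Q) _ Qu Nu.
by rewrite mem_morphim ?(hom_mem Fa).
Qed.

Lemma mem_Nphi {Q a u} : a \in AutF F Q -> u \in 'N_S(Q) ->
  conj_aut Q u ^ a \in Aut_by S Q -> u \in Nphi S Q a.
Proof.
move=> AFa NSu /Aut_byP[v NSv defv]; rewrite inE NSu AutF_im //.
have Aa := AutF_Aut AFa; case/setIP: NSu => _ Nu.
apply/exists_inP; exists v => //; apply/forall_inP=> x Qx.
rewrite -(conj_autJ Nu Qx) defv norm_conj_autE //; first by case/setIP: NSv.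
by rewrite Aut_closed.
Qed.

Lemma sub_Nphi {Q a} : Q \subset S -> a \in AutF F Q -> Q \subset Nphi S Q a.
Proof.
move=> sQS AFa; apply/subsetP=> u Qu.
have Aa := AutF_Aut AFa.
rewrite inE inE (subsetP sQS) // (subsetP (normG Q)) //= AutF_im //.
apply/exists_inP; exists (a u).
  by rewrite inE (subsetP sQS) ?(subsetP (normG Q)) // Aut_closed.
by apply/forall_inP=> x Qx; rewrite (hom_conjg (AutF_hom sQS AFa)).
Qed.

(** * Strongly closed subgroups *)

Lemma strongly_closed_mem {U A B f x} : strongly_closed F U ->
  hom F A B f -> x \in A -> x \in U -> f x \in U.
Proof.
case=> _ scU Ff Ax Ux; apply: scU => //.
by apply: (hom_sub (hom_widen Ff)); rewrite ?cycle_subG // => y xy;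
   apply: (hom_mem (hom_widen Ff)); apply: subsetP xy; rewrite cycle_subG.
Qed.

Lemma strongly_closed_memV {U A B f x} : strongly_closed F U ->
  hom F A B f -> x \in A -> f x \in U -> x \in U.
Proof.
move=> scU /hom_image[C _ [Ff [h [Fh fK _]]]] Ax Ufx.
by rewrite -(fK x Ax) (strongly_closed_mem scU Fh) // (hom_mem Ff).
Qed.

Lemma strongly_closed_normal {U} : strongly_closed F U -> U <| S.
Proof.
move=> scU; have [sUS _] := scU; rewrite /normal sUS; apply/subsetP=> u Su.
rewrite inE; apply/subsetP=> _ /imsetP[x Ux ->].
have Fg := hom_conj F (subxx S) (subxx S) Su.
by apply: (strongly_closed_mem scU (Fg _)); rewrite ?conjGid // (subsetP sUS).
Qed.

Lemma strongly_closedT : strongly_closed F S.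
Proof.
by split=> // x f Sx Ff; rewrite (hom_mem Ff) ?cycle_id.
Qed.

(** Both [f] and its inverse preserve U. Hence the measure of the later induction is constant on
    conjugacy classes. *)
Lemma card_strongly_closedI {U A B f} : strongly_closed F U ->
  fs_iso F A B f -> #|A :&: U| = #|B :&: U|.
Proof.
move=> scU isof; have [Ff _] := isof.
have -> : B :&: U = f @: (A :&: U).
  apply/setP=> y; apply/setIP/imsetP=> [[] | [x /setIP[Ax Ux] ->]].
    rewrite -(fs_iso_im isof) => /imsetP[x Ax ->] Ufx; exists x => //.
    by rewrite inE Ax (strongly_closed_memV scU Ff).
  by rewrite (hom_mem Ff) ?(strongly_closed_mem scU Ff).
rewrite card_in_imset // => x y /setIP[Ax _] /setIP[Ay _].
exact: (hom_injective Ff).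
Qed.

Lemma strongly_closed_im {U A B f} : strongly_closed F U ->
  U \subset A -> hom F A B f -> f @: U = U.
Proof.
move=> scU sUA Ff; apply/eqP; rewrite eqEcard; apply/andP; split.
  apply/subsetP=> _ /imsetP[x Ux ->].
  by rewrite (strongly_closed_mem scU Ff) // (subsetP sUA).
rewrite card_in_imset // => x y Ux Uy.
by apply: (hom_injective Ff); apply: (subsetP sUA).
Qed.

(** * Fully normalized subgroups and saturation *)

Lemma exists_fully_normalized A : A \subset S ->
  exists R f, fs_iso F A R f /\ fully_normalized F R.
Proof.
move=> sAS.
(* Finite functions replace functions here, so that conjugacy becomes a boolean predicate and a
   maximal normalizer can be chosen. *)
pose conjA R := [exists f : {ffun gT -> gT}, hom F A S f && (f @: A == R)].
have conjAP R : reflect (exists f, fs_iso F A R f) (conjA R).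
  apply: (iffP existsP) => [[f /andP[Ff /eqP fA]] | [f isof]].
    by exists f; apply: fs_iso_of_im.
  have [/hom_widen Ff _] := isof.
  exists (finfun f); rewrite (hom_ext _ Ff) => [|x _]; last by rewrite ffunE.
  rewrite -(fs_iso_im isof); apply/eqP/eq_imset=> x; exact: ffunE.
have conjA_A: conjA A by apply/conjAP; exists id; apply: fs_iso_refl.
case: (@arg_maxnP _ A conjA (fun R => #|'N_S(R)|) conjA_A).
move=> R /conjAP[f isof] maxR.
exists R, f; do 2?split => //; first by case: isof => /hom_cod.
by move=> B [g isog]; apply: maxR; apply/conjAP; exists (g \o f);
   apply: fs_iso_comp isof isog.
Qed.

Variable p : nat.
Hypotheses (pS : p.-group S) (satF : saturated F p).

Lemma pgroup_Aut_by Q : p.-group (Aut_by S Q).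
Proof. by rewrite morphim_pgroup // (pgroupS _ pS) ?subsetIl. Qed.

Lemma Sylow_Aut_by Q :
  fully_normalized F Q -> p.-Sylow(AutF F Q) (Aut_by S Q).
Proof. by case: satF => satQ _ /satQ[]. Qed.

Lemma extend_to_Nphi {Q R f} : fully_normalized F R -> fs_iso F Q R f ->
  exists f', hom F (Nphi_group S Q f) S f' /\ {in Q, f' =1 f}.
Proof.
case: satF => sat1 sat2 /sat1[fcR _] isof; have [/hom_widen Ff _] := isof.
exact: sat2 Ff (fs_iso_im isof) fcR.
Qed.

(** Transport by [f] turns Aut_S(A) into a p-subgroup K of Aut_F(R). Since Aut_S(R) is Sylow there,
    some c in Aut_F(R) conjugates K into it. Then the domain [Nphi] of [c \o f] is all of N_S(A),
    and saturation applies. On A the resulting map is [c \o f], not [f]. *)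
Lemma normalizer_map {A R f} : fully_normalized F R -> fs_iso F A R f ->
  exists g, hom F 'N_S(A)%G S g /\ g @: A = R.
Proof.
move=> fnR isof; have [Ff [h [Fh fK hK]]] := isof.
have sAS := hom_dom Ff; have sRS := hom_cod Ff.
case: (hom_inj Ff) => _ _ Mf injf _.
pose fm := morphm_morphism Mf.
have injfm : 'injm fm.
  exact/injmP.
have fmE x : fm x = f x by [].
have fmA : fm @* A = R.
  rewrite -(fs_iso_im isof) morphimEdom; apply: eq_imset=> x; exact: fmE.
pose K := (Aut_isom injfm (subxx A) @* Aut_by S A)%G.
have isomE b : b \in AutF F A ->
    {in A, forall x, Aut_isom injfm (subxx A) b (f x) = f (b x)}.
  move=> AFb x Ax; rewrite -!fmE Aut_isomE //.
  exact: (subsetP AutF_sub_Aut).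
have sKR : K \subset AutF F R.
  apply/subsetP=> _ /morphimP[b _ Sb ->].
  have AFb := subsetP (Aut_by_sub_AutF sAS) _ Sb.
  rewrite inE; apply/andP; split.
    by have := Aut_Aut_isom injfm (subxx A) b; rewrite fmA.
  apply/implyP=> _.
  apply: hom_ext (hom_comp (hom_comp Fh (AutF_hom sAS AFb)) Ff) => y Ry /=.
  by rewrite -{2}(hK y Ry) isomE // (hom_mem Fh).
have pK : p.-group K by rewrite morphim_pgroup // pgroup_Aut_by.
have [c AFc sKc] := Sylow_Jsub (Sylow_Aut_by fnR) sKR pK.
have isoc := AutF_iso sRS AFc.
have isocf := fs_iso_comp isof isoc.
have [g [Fg gE]] := extend_to_Nphi fnR isocf.
exists g; split; last first.
  by rewrite -(fs_iso_im isocf); apply: eq_in_imset.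
suff sN : 'N_S(A) \subset Nphi S A (c \o f).
  apply: (hom_sub Fg) => // x Nx.
  by rewrite (hom_mem Fg) //; apply: subsetP Nx.
apply/subsetP=> u Nu; rewrite inE Nu (fs_iso_im isocf) /=.
have Ku : Aut_isom injfm (subxx A) (conj_aut A u) \in K.
  rewrite mem_morphim //; last by apply/Aut_byP; exists u.
  exact: (subsetP AutF_sub_Aut _ (conj_aut_AutF sAS Nu)).
have := Ku; rewrite -(memJ_conjg _ c).
move/(subsetP sKc)/Aut_byP=> [v Nv defv].
apply/exists_inP; exists v => //; apply/forall_inP=> x Ax /=.
have [[_ Nu'] [_ Nv']] := (setIP Nu, setIP Nv).
have Rcfx : c (f x) \in R by rewrite (hom_mem isoc.1) // (hom_mem Ff).
rewrite -(norm_conj_autE Nv' Rcfx) -defv permJ isomE //.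
  by rewrite norm_conj_autE.
exact: conj_aut_AutF.
Qed.

End FusionSystems.

(** * Extension of morphisms from A to PA *)

Section Extensions.

Variables (gT : finGroupType) (p : nat) (S P : {group gT}).
Variable F : fusion_system S.
Hypotheses (pS : p.-group S) (satF : saturated F p).
Hypothesis scP : strongly_closed F P.
Implicit Types (A B C D Q R U : {group gT}) (f g h : gT -> gT).
Implicit Types (a b : {perm gT}) (u v x y : gT).

Let sPS : P \subset S. Proof. by case: scP. Qed.

Definition extends_to A B f := exists g, hom F B S g /\ {in A, g =1 f}.

Local Notation extends A f := (extends_to A (P <*> A)%G f).

Lemma extendsS A B D f :
  extends_to A D f -> B \subset D -> extends_to A B f.
Proof.
case=> g [Fg gE] sBD; exists g; split=> //.
by apply: (hom_sub Fg) => // x Bx; rewrite (hom_mem Fg) // (subsetP sBD).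
Qed.

Lemma eq_extends A B f g :
  {in A, f =1 g} -> extends_to A B f -> extends_to A B g.
Proof.
by move=> fg [k [Fk kE]]; exists k; split=> // x Ax; rewrite kE ?fg.
Qed.

Lemma mem_joinP A x : A \subset S ->
  reflect (exists u, exists v, [/\ u \in P, v \in A & x = u * v])
          (x \in (P <*> A)%G).
Proof.
move=> sAS; rewrite /= norm_joinEr; last first.
  by rewrite (subset_trans sAS) // normal_norm // (strongly_closed_normal scP).
by apply: (iffP mulsgP) => [[u v Pu Av ->] | [u [v [Pu Av ->]]]];
  [exists u, v | exists u v].
Qed.

(** As P is normal in S, the join is the product PA, and [g] maps P into P by strong closure. So the
    target S in [extends_to] can always be sharpened to PB. *)
Lemma hom_join {A B f g} :
    hom F A B f -> hom F (P <*> A)%G S g -> {in A, g =1 f} ->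
  hom F (P <*> A)%G (P <*> B)%G g.
Proof.
move=> Ff Fg gE.
apply: (hom_sub Fg); rewrite // ?join_subG ?sPS ?(hom_cod Ff) // => z.
case/(mem_joinP _ (hom_dom Ff))=> x [y [Px Ay ->]].
have JP u : u \in P -> u \in P <*> A by apply/subsetP/joing_subl.
have JA u : u \in A -> u \in P <*> A by apply/subsetP/joing_subr.
have -> : g (x * y) = g x * f y.
  by rewrite (hom_morph Fg (JP x Px) (JA y Ay)) (gE y).
apply/(mem_joinP _ (hom_cod Ff)).
exists (g x), (f y); split=> //; last exact: hom_mem Ff Ay.
by apply: (strongly_closed_mem scP Fg) => //; apply: JP.
Qed.

Lemma extends_comp A B f g : hom F A B f ->
  extends A f -> extends B g -> extends A (g \o f).
Proof.
move=> Ff [f' [Ff' fE]] [g' [Fg' gE]]; exists (g' \o f'); split.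
  exact: hom_comp (hom_join Ff Ff' fE) Fg'.
by move=> x Ax; rewrite /= fE // gE // (hom_mem Ff).
Qed.

(** The image of the extension of [f] contains P, which it maps onto itself, and C, the image of A.
    So its inverse can be restricted to PC. *)
Lemma extends_inv A C f h : hom F A C f -> hom F C A h -> {in C, cancel h f} ->
  extends A f -> extends C h.
Proof.
move=> Ff Fh hK [f' [Ff' fE]].
have [D defD isof'] := hom_image Ff'.
have [h' [[Fh' _] fK' hK']] := fs_iso_inv isof'.
have JA u : u \in A -> u \in P <*> A by apply/subsetP/joing_subr.
exists h'; split.
  suff sJD : P <*> C \subset D.
    apply: (hom_sub (hom_widen Fh')) => // x Jx.
    by apply: (hom_mem (hom_widen Fh')); apply: (subsetP sJD).
  rewrite join_subG; apply/andP; split.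
    rewrite defD -{1}(strongly_closed_im scP _ Ff') ?joing_subl //.
    by rewrite imsetS ?joing_subl.
  apply/subsetP=> x Cx; rewrite -(hK x Cx) -fE ?(hom_mem Fh) //.
  by rewrite defD imset_f // JA // (hom_mem Fh).
move=> x Cx; rewrite -{1}(hK x Cx) -fE ?fK' ?JA //; exact: (hom_mem Fh).
Qed.

(** Normalizers grow in the p-group PR: some z = uv outside R, with u in P and v in R, normalizes R,
    and then so does u = z v^-1. *)
Lemma exists_normalizer_notin R : R \subset S -> ~~ (P \subset R) ->
  exists2 u, u \in P :\: R & u \in 'N(R).
Proof.
move=> sRS not_sPR.
have ltRJ : R \proper P <*> R.
  by rewrite properE joing_subr join_subG negb_and not_sPR.
have pJ : p.-group (P <*> R) by rewrite (pgroupS _ pS) // join_subG sPS.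
have /properP[_ [z /setIP[Jz Nz] notRz]] :=
  nilpotent_proper_norm (pgroup_nil pJ) ltRJ.
have /(mem_joinP _ sRS)[u [v [Pu Rv defz]]] := Jz; exists u.
  by rewrite inE Pu andbT; apply: contra notRz => Ru; rewrite defz groupM.
have -> : u = z * v^-1 by rewrite defz mulgK.
by apply: groupM Nz _; rewrite groupV (subsetP (normG R)).
Qed.

(* Downward induction on [A :&: P].  [N_P(A)] is not contained in [A], so the
   maps of normalizers into [N_S(R)], [R] fully normalized, extend by induction;
   composing with them turns [f] into an automorphism of [R]. *)
Lemma extends_ind U : P \subset U -> strongly_closed F U ->
    (forall R, R \subset U -> ~~ (P \subset R) -> fully_normalized F R ->
      {in AutF F R, forall a,
        (exists2 u, u \in P :\: R & u \in Nphi S R a) -> extends R a} ->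
      {in AutF F R, forall a, extends R a}) ->
  forall A f, A \subset U -> hom F A S f -> extends A f.
Proof.
move=> sPU scU extR A f; have sUS : U \subset S by case: scU.
have [n] := ubnP (#|P| - #|A :&: P|); elim: n => // n IHn in A f *.
move=> ltPn sAU Ff; have sAS := subset_trans sAU sUS.
have [sPA | not_sPA] := boolP (P \subset A).
  have sJA : P <*> A \subset A by rewrite join_subG sPA subxx.
  exists f; split=> //; apply: (hom_sub Ff) => // x Jx.
  by apply: (hom_mem Ff); apply: (subsetP sJA).
have IH B R g : #|R :&: P| = #|A :&: P| -> B \subset U ->
    R :&: P \proper B :&: P -> hom F B S g -> extends B g.
  move=> cardR sBU ltRB Fg; apply: IHn => //; apply: leq_trans (ltPn : _ <= n).
  have:= proper_card ltRB; rewrite cardR => ltAB; rewrite ltn_sub2l //.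
  by apply: leq_trans ltAB _; rewrite subset_leq_card ?subsetIr.
have [R [f0 [isof0 fnR]]] := exists_fully_normalized F sAS.
have [C _ isof] := hom_image Ff; have [FfC _] := isof.
have [h [isoh fK hK]] := fs_iso_inv isof.
have cardI Q g : fs_iso F A Q g -> #|Q :&: P| = #|A :&: P|.
  by move=> isog; rewrite (card_strongly_closedI scP isog).
have subU Q g : fs_iso F A Q g -> Q \subset U.
  move=> isog; rewrite -(fs_iso_im isog); apply/subsetP=> _ /imsetP[x Ax ->].
  by apply: (strongly_closed_mem scU isog.1 Ax); apply: subsetP Ax.
have proper_norm Q : #|Q :&: P| = #|A :&: P| -> Q \subset S ->
    exists2 u, u \in P :\: Q & u \in 'N(Q).
  move=> cardQ sQS; apply: exists_normalizer_notin => //.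
  apply: contra not_sPA => sPQ.
  by apply/setIidPr/eqP; rewrite eqEcard subsetIr -cardQ (setIidPr sPQ) /=.
(* [normalizer_map] may change the given isomorphism from Q to R, but its restriction to N_U(Q)
   extends by induction, because N_U(Q) meets P in more than Q does. *)
have toR Q g : fs_iso F A Q g -> forall k, fs_iso F Q R k ->
    exists g', fs_iso F Q R g' /\ extends Q g'.
  move=> isog k isok; have [k' [Fk' k'Q]] := normalizer_map pS satF fnR isok.
  have sQS := hom_cod isog.1; have sQU := subU _ _ isog.
  have sQN : Q \subset 'N_S(Q) by rewrite subsetI sQS normG.
  exists k'; split.
    apply: fs_iso_of_im k'Q; apply: (hom_sub Fk') => // x Qx.
    by rewrite (hom_mem Fk') ?(subsetP sQN).
  have sNUS : 'N_U(Q) \subset 'N_S(Q) by rewrite setSI.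
  have /(IH 'N_U(Q)%G Q) : #|Q :&: P| = #|A :&: P| by apply: cardI isog.
  move=> /(_ k' (subsetIl _ _))[||g' [Fg' g'E]].
  - have [u /setDP[Pu notQu] Nu] := proper_norm Q (cardI _ _ isog) sQS.
    apply/properP; split; first by rewrite setSI // subsetI sQU normG.
    exists u; first by rewrite !in_setI Nu Pu (subsetP sPU).
    by rewrite inE negb_and notQu.
  - by apply: (hom_sub Fk') => // x Nx; rewrite (hom_mem Fk') ?(subsetP sNUS).
  have sQN' : Q \subset 'N_U(Q) by rewrite subsetI sQU normG.
  apply: (@extendsS _ _ (P <*> 'N_U(Q))%G); last by rewrite genS ?setUS.
  by exists g'; split=> // x Qx; rewrite g'E ?(subsetP sQN').
have [c1 [iso1 ext1]] := toR _ _ (fs_iso_refl F sAS) _ isof0.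
have [c2 [iso2 ext2]] := toR _ _ isof _ (fs_iso_comp isoh isof0).
have [d1 [isod1 c1K d1K]] := fs_iso_inv iso1.
have [d2 [isod2 c2K d2K]] := fs_iso_inv iso2.
(* With C the image of [f], this writes [f] on A as [c1], then [a], then the inverse [d2] of [c2];
   only the extension of [a] is still missing. *)
have [a AFa aE] := hom_AutF (fs_iso_comp (fs_iso_comp isod1 isof) iso2).1.
have sRS := fnR.1; have sRU := subU _ _ isof0; have cardR := cardI _ _ isof0.
have exta : extends R a.
  apply: extR AFa => //.
    have [u /setDP[Pu notRu] _] := proper_norm R cardR sRS.
    by apply/subsetPn; exists u.
  move=> b AFb [u /setDP[Pu notRu] Nu].
  have [b' [Fb' b'E]] := extend_to_Nphi satF fnR (AutF_iso sRS AFb).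
  (* Intersecting with U keeps the domain in the range of the induction, and it still contains [u],
     as P lies in U. *)
  pose B := (Nphi_group S R b :&: U)%G.
  have sRB : R \subset B by rewrite subsetI (sub_Nphi sRS AFb) sRU.
  have FBb' : hom F B S b'.
    apply: (hom_sub Fb'); rewrite ?subsetIl // => x /setIP[Nx _].
    exact: (hom_mem Fb').
  have [|b2 [Fb2 b2E]] := IH B R b' cardR (subsetIr _ _) _ FBb'.
    apply/properP; split; first by rewrite setSI.
    exists u; first by rewrite !in_setI Nu Pu (subsetP sPU).
    by rewrite inE negb_and notRu.
  apply: (@extendsS _ _ (P <*> B)%G); last by rewrite genS ?setUS.
  by exists b2; split=> // x Rx; rewrite b2E ?b'E ?(subsetP sRB).
have extd2 : extends R d2 := extends_inv iso2.1 isod2.1 d2K ext2.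
have FRR := AutF_hom sRS AFa.
apply: (eq_extends (f := d2 \o (a \o c1))) => [x Ax /=|].
  by rewrite aE /= ?c1K ?c2K // ?(hom_mem iso1.1) ?(hom_mem FfC).
apply: extends_comp extd2; first exact: hom_comp iso1.1 FRR.
exact: extends_comp iso1.1 ext1 exta.
Qed.

End Extensions.

Lemma mem_quotientV (gT : finGroupType) (A H : {group gT}) (x : gT) :
  H <| A -> x \in 'N(H) -> coset H x \in A / H -> x \in A.
Proof. by move=> nHA Nx Ax; rewrite -(quotientGK nHA) mem_morphpre. Qed.

(** * Extendible automorphisms and essential subgroups *)

Section Essential.

Variables (gT : finGroupType) (p : nat) (S P : {group gT}).
Variable F : fusion_system S.
Hypotheses (pS : p.-group S) (satF : saturated F p).
Hypothesis scP : strongly_closed F P.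
Implicit Types (A B C D Q R U : {group gT}) (f g h : gT -> gT).
Implicit Types (a b : {perm gT}) (u v x y : gT).

Local Notation extends A f := (extends_to F A (P <*> A)%G f).

Let sPS : P \subset S. Proof. by case: scP. Qed.

(** By assumption [u] lies in N_a, so [a] extends to a map f defined at [u]. The conjugate is
    induced by f(u), which is in P by strong closure. This makes Out_P(R) strongly closed in
    Out_S(R). *)
Lemma Aut_by_conj_closed R a u : fully_normalized F R -> a \in AutF F R ->
    u \in 'N_P(R) -> conj_aut R u ^ a \in Aut_by S R ->
  conj_aut R u ^ a \in Aut_by P R.
Proof.
move=> fnR AFa /setIP[Pu Nu] Sua; have sRS := fnR.1.
have NSu : u \in 'N_S(R) by rewrite in_setI (subsetP sPS).
have Nphi_u := mem_Nphi AFa NSu Sua.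
have [f [Ff fE]] := extend_to_Nphi satF fnR (AutF_iso sRS AFa).
have Pfu : f u \in P by apply: (strongly_closed_mem scP Ff).
have [Nfu ->] := conj_aut_extension AFa Ff (sub_Nphi sRS AFa) fE Nphi_u Nu.
by apply/Aut_byP; exists (f u); rewrite // in_setI Pfu.
Qed.

Lemma extends_mul R a b : R \subset S -> a \in AutF F R -> b \in AutF F R ->
  extends R a -> extends R b -> extends R (a * b)%g.
Proof.
move=> sRS AFa AFb exta extb.
apply: (eq_extends (f := b \o a)) => [x _|]; first by rewrite permM.
exact: (extends_comp scP (AutF_hom sRS AFa) exta extb).
Qed.

Lemma extends_Aut_by R a : R \subset S -> a \in Aut_by S R -> extends R a.
Proof.
move=> sRS /Aut_byP[u /setIP[Su Nu] ->]; exists (conjg^~ u); split.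
  apply: hom_conj; rewrite ?join_subG ?sPS // conj_subG // join_subG ?sPS //.
by move=> x Rx; rewrite /= norm_conj_autE.
Qed.

Section ExtendibleProper.

Variable R : {group gT}.
Hypotheses (fnR : fully_normalized F R) (sCR : 'C_P(R) \subset R).
Hypothesis (ltRP : R \proper P).
Hypothesis extR : {in AutF F R, forall a,
  (exists2 u, u \in P :\: R & u \in Nphi S R a) -> extends R a}.

Let sRS : R \subset S. Proof. exact: fnR.1. Qed.
Let sRP : R \subset P. Proof. exact: proper_sub ltRP. Qed.

(** For a conjugate C of R, [normalizer_map] provides an injective g on N_S(C) taking C to R. It
    sends C_P(C) into C_P(R), hence into R, the image of C. *)
Lemma centric_wrt_of_fully_normalized : centric_wrt F P R.
Proof.
split=> // f Ff; have [C defC isof] := hom_image Ff; rewrite -defC.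
have [h [isoh _ _]] := fs_iso_inv isof.
have [g [Fg gC]] := normalizer_map pS satF fnR isoh.
have sCS := hom_cod isof.1.
apply/subsetP=> x /setIP[Px Cx].
have sCN : C \subset 'N_S(C) by rewrite subsetI sCS normG.
have Nx : x \in 'N_S(C).
  by rewrite in_setI (subsetP sPS) // (subsetP (cent_sub C)).
have: g x \in R.
  apply: (subsetP sCR); rewrite in_setI (strongly_closed_mem scP Fg) //.
  apply/centP=> y; rewrite -{1}gC => /imsetP[z Cz ->].
  have Nz := subsetP sCN _ Cz.
  by rewrite /commute -!(hom_morph Fg) // (centP Cx).
rewrite -{1}gC => /imsetP[z Cz /(hom_injective Fg)->] //.
exact: (subsetP sCN).
Qed.

Definition extendible : {set {perm gT}} :=
  [set a in AutF F R | [exists f : {ffun gT -> gT},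
     hom F (P <*> R)%G S f && [forall x in R, f x == a x]]].

Lemma extendibleP a :
  reflect (a \in AutF F R /\ extends R a) (a \in extendible).
Proof.
apply: (iffP setIdP) => -[AFa].
  by case/existsP=> f /andP[Ff /forall_inP fE]; split=> //; exists f;
     split=> // x /fE/eqP.
case=> f [Ff fE]; split=> //; apply/existsP; exists (finfun f).
rewrite (hom_ext _ Ff) => [|x _]; last by rewrite ffunE.
by apply/forall_inP=> x Rx; rewrite ffunE fE.
Qed.

Lemma extendible_group_set : group_set extendible.
Proof.
apply/group_setP; split.
  apply/extendibleP; split; first exact: group1.
  by apply: extends_Aut_by => //; apply: group1.
move=> a b /extendibleP[AFa exta] /extendibleP[AFb extb].
by apply/extendibleP; split; [apply: groupM | apply: extends_mul].
Qed.

Canonical extendible_group := Group extendible_group_set.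

Lemma Aut_by_sub_extendible : Aut_by S R \subset extendible.
Proof.
apply/subsetP=> a Sa; apply/extendibleP.
by split; [apply: (subsetP (Aut_by_sub_AutF F sRS)) | apply: extends_Aut_by].
Qed.

Lemma extendible_sub : extendible \subset AutF F R.
Proof. by apply/subsetP=> a /extendibleP[]. Qed.

Lemma normal_Inn (A : {group {perm gT}}) :
  Inn R \subset A -> A \subset AutF F R -> Inn R <| A.
Proof.
move=> sIA sAF.
by rewrite /normal sIA (subset_trans sAF (Inn_norm_AutF F sRS)).
Qed.

(** The embedded subgroup H is the image of [extendible] in Out_F(R). The point is that an element
    of Out_F(R) which conjugates a nontrivial subgroup of Out_P(R) into H already lies in H. *)
Lemma extendible_proper_essential :
  extendible \proper AutF F R -> essential_wrt F p P R.
Proof.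
move=> ltHG; have nIG := Inn_norm_AutF F sRS.
have sIS := Inn_sub_Aut_by sRS.
have sSG := Aut_by_sub_AutF F sRS; have sSH := Aut_by_sub_extendible.
have sPSa : Aut_by P R \subset Aut_by S R := Aut_byS sPS.
have sIH : Inn R \subset extendible := subset_trans sIS sSH.
have normS : Inn R <| Aut_by S R by apply: normal_Inn.
have nIP : Aut_by P R \subset 'N(Inn R).
  by rewrite (subset_trans sPSa) // normal_norm.
have sylT : p.-Sylow(OutF F R) (Out_by S R).
  by apply: quotient_pHall (Sylow_Aut_by satF fnR); rewrite (subset_trans sSG).
have sylTH : p.-Sylow(extendible_group / Inn R)%G (Out_by S R).
  by apply: pHall_subl sylT; rewrite quotientS ?extendible_sub.
split=> //; first exact: centric_wrt_of_fully_normalized.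
exists (extendible_group / Inn R)%G; split.
- split=> //.
    rewrite -subG1 quotient_sub1 //.
    have [u /setDP[Pu notRu] Nu] :=
      exists_normalizer_notin pS scP sRS (proper_subn ltRP).
    (* If conjugation by [u] agrees on R with conjugation by some v in R, then u v^-1 lies in
       C_P(R), hence in R. *)
    apply: contra notRu => sPI; have: conj_aut R u \in Inn R.
      by apply: (subsetP sPI); apply/Aut_byP; exists u; rewrite // in_setI Pu.
    case/morphimP=> v Nv Rv eq_uv; have Nuv : u * v^-1 \in 'N(R).
      by apply: groupM Nu _; rewrite groupV.
    suff Cuv : u * v^-1 \in 'C_P(R).
      by rewrite -(mulgKV v u); apply: groupM (subsetP sCR _ Cuv) Rv.
    rewrite in_setI; apply/andP; split.
      by apply: groupM Pu _; rewrite groupV (subsetP sRP).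
    rewrite -ker_conj_aut; apply/kerP => //.
    by rewrite morphM ?groupV //= morphV //= eq_uv mulgV.
  split; [exact: quotientS | exact: quotientS | ].
  move=> _ _ /morphimP[b Nb Pb ->] /morphimP[a Na AFa ->].
  have Nba : b ^ a \in 'N(Inn R) by rewrite groupJ.
  rewrite -morphJ //= => /(mem_quotientV normS Nba) Sba; apply: mem_quotient.
  by have /Aut_byP[u Nu defb] := Pb; rewrite defb Aut_by_conj_closed // -defb.
- rewrite properE quotientS ?extendible_sub //=.
  by rewrite quotientSK // mulSGid // proper_subn.
- by exists 1; rewrite ?group1 ?conjsg1 ?quotientS // (subset_trans sPSa).
(* A nontrivial w in V comes from some u in N_P(R), and u is outside R since w is nontrivial. The
   conjugate of c_u under [a] is induced by S, so u lies in N_a and [extR] applies. *)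
have fusion_in_H (V : {group coset_of (Inn R)}) (y : coset_of (Inn R)) :
    V \subset Out_by P R -> V :!=: 1 ->
    y \in OutF F R -> V :^ y \subset Out_by S R ->
    y \in extendible_group / Inn R.
  move=> sVD /trivgPn[w Vw ntw] /morphimP[a Na AFa ->] sVT.
  case/morphimP: (subsetP sVD _ Vw) => b Nb /Aut_byP[u Nu defb] defw.
  apply: mem_quotient; apply/extendibleP; split=> //.
  have Nba : b ^ a \in 'N(Inn R) by rewrite groupJ.
  have := Vw; rewrite -(memJ_conjg _ (coset (Inn R) a)) => /(subsetP sVT).
  rewrite defw -morphJ //= => /(mem_quotientV normS Nba) Sba.
  have /setIP[Pu Nu'] := Nu.
  apply: extR => //; exists u; last first.
    by apply: (mem_Nphi AFa); rewrite -?defb // in_setI (subsetP sPS).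
  rewrite in_setD Pu andbT; apply: contra ntw => Ru.
  by rewrite defw /= coset_id // defb mem_morphim.
move=> g /setDP[Gg notHg] U x sUD ntU Gx; apply: contra notHg.
(* Both U^x and U^(x g^-1) lie in H, so x and x g^-1 do as well, and therefore g does. *)
rewrite subsetI => /andP[sUxH]; rewrite -sub_conjgV -conjsgM => sUxgH.
have sHG : (extendible_group / Inn R)%G \subset OutF F R.
  by rewrite quotientS ?extendible_sub.
have pU : p.-group U.
  by rewrite (pgroupS sUD) // (pgroupS _ (pHall_pgroup sylT)) ?quotientS.
(* Out_S(R) is also Sylow in H, so some z in H moves U^y into Out_S(R); [fusion_in_H] then applies
   to y z. *)
have conj_in_H (y : coset_of (Inn R)) : y \in OutF F R ->
    U :^ y \subset extendible_group / Inn R ->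
    y \in extendible_group / Inn R.
  move=> Gy sUyH.
  have [z Hz] := Sylow_Jsub sylTH sUyH (etrans (pgroupJ _ _ _) pU).
  rewrite -conjsgM => sUyz; have Gyz := groupM Gy (subsetP sHG _ Hz).
  by have := fusion_in_H U _ sUD ntU Gyz sUyz; rewrite groupMr.
have Hx := conj_in_H x Gx sUxH.
have Gxg : x * g^-1 \in OutF F R by rewrite groupM ?groupV.
by have := conj_in_H _ Gxg sUxgH; rewrite groupMl // groupV.
Qed.

End ExtendibleProper.

(** * Extension of all morphisms in the absence of essential subgroups *)

Hypothesis noess : ~ exists Q, essential_wrt F p P Q.

Lemma extends_below A f : A \subset P -> hom F A S f -> extends A f.
Proof.
apply: (extends_ind pS satF scP (subxx P) scP) => R sRP not_sPR fnR extR a AFa.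
have ltRP : R \proper P by rewrite properE sRP.
have sRS := fnR.1.
have [sCR | ] := boolP ('C_P(R) \subset R); last first.
  case/subsetPn=> u /setIP[Pu Cu] notRu.
  apply: extR => //; exists u; first by rewrite in_setD notRu.
  rewrite inE in_setI (subsetP sPS) // (subsetP (cent_sub R)) //=.
  (* Conjugation by [u] is trivial on R, so its conjugate under [a] is conjugation by 1. *)
  apply/exists_inP; exists 1; rewrite ?group1 //; apply/forall_inP=> x Rx.
  by rewrite conjg1 /conjg -(centP Cu) ?mulKg.
suff: a \in extendible R by case/extendibleP.
apply: contraT => notHa; case: noess; exists R.
apply: extendible_proper_essential => //.
rewrite properE extendible_sub; apply/subsetPn; by exists a.
Qed.

Lemma extends_any A f : hom F A S f -> extends A f.
Proof.
move=> Ff; have sAS := hom_dom Ff; move: A f sAS Ff.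
apply: (extends_ind pS satF scP sPS (strongly_closedT F)).
move=> R sRS not_sPR fnR extR a AFa; apply: extR => //.
have [u Du Nu] := exists_normalizer_notin pS scP sRS not_sPR; exists u => //.
have /setDP[Pu _] := Du.
have NSu : u \in 'N_S(R) by rewrite in_setI (subsetP sPS).
(* By [extends_below] the group [N] below is normal in [AutF F R].  It is a
   p-group, so it lies in the Sylow subgroup [Aut_by S R]; it contains
   [conj_aut R u], whose conjugate under [a] is thus induced by [S]. *)
pose Q := (R :&: P)%G.
pose N := [set b in AutF F R | [forall x in R, x^-1 * b x \in P]
  && [exists v in P, [forall x in Q, b x == x ^ v]]].
have NP b : reflect [/\ b \in AutF F R, {in R, forall x, x^-1 * b x \in P}
    & exists2 v, v \in P & {in Q, forall x, b x = x ^ v}] (b \in N).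
  apply: (iffP setIdP) => [[AFb /andP[]] | [AFb]].
    move=> /forall_inP bR /exists_inP[v Pv /forall_inP bQ].
    by split=> //; exists v => // x /bQ/eqP.
  move=> bR [v Pv bQ]; split=> //; apply/andP; split; first exact/forall_inP.
  by apply/exists_inP; exists v => //; apply/forall_inP=> x Qx; rewrite bQ.
have AR b x : b \in AutF F R -> x \in R -> b x \in R.
  by move=> AFb; apply: hom_mem (AutF_hom sRS AFb).
have AQ b x : b \in AutF F R -> x \in Q -> b x \in Q.
  move=> AFb /setIP[Rx Px]; rewrite in_setI AR //.
  exact: strongly_closed_mem scP (AutF_hom sRS AFb) Rx Px.
have gN : group_set N.
  apply/group_setP; split.
    apply/NP; split=> [|x _|]; first exact: group1.
      by rewrite perm1 mulVg.
    by exists 1 => // x _; rewrite perm1 conjg1.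
  move=> b c /NP[AFb bR [v Pv bQ]] /NP[AFc cR [w Pw cQ]].
  apply/NP; split=> [|x Rx|]; first exact: groupM.
    by rewrite permM -[c _](mulKVg (b x)) mulgA groupM ?bR ?cR ?AR.
  exists (v * w) => [|x Qx]; first exact: groupM.
  by rewrite permM conjgM -bQ ?cQ ?AQ.
pose Ng := Group gN.
have sNG : Ng \subset AutF F R by apply/subsetP=> b /NP[].
have nNG : AutF F R \subset 'N(Ng).
  apply/subsetP=> c AFc; rewrite inE.
  apply/subsetP=> _ /imsetP[b /NP[AFb bR [v Pv bQ]] ->].
  have cM := hom_morph (AutF_hom sRS AFc).
  have cV := homV (AutF_hom sRS AFc).
  apply/NP; split=> [|x|]; first exact: groupJ.
    rewrite -{1}(AutF_im AFc) => /imsetP[y Ry ->]; rewrite permJ.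
    rewrite -cV // -cM ?groupV ?AR //.
    apply: (strongly_closed_mem scP (AutF_hom sRS AFc)); last exact: bR.
    by rewrite groupM ?groupV ?AR.
  have FQ : hom F Q S c.
    apply: (hom_sub (AutF_homS sRS AFc)); rewrite ?subsetIl //.
    by move=> x /setIP[Rx _]; rewrite (subsetP sRS) ?AR.
  (* The extension [c'] is defined on PQ = P, so the conjugate of [b] under [c] acts on Q as
     conjugation by c'(v). *)
  have [c' [Fc' cE]] := extends_below (subsetIr R P) FQ.
  have JP x : x \in P -> x \in P <*> Q by apply/subsetP/joing_subl.
  exists (c' v) => [|x Qx].
    exact: (strongly_closed_mem scP Fc' (JP v Pv)).
  have Qy : (c^-1)%g x \in Q by rewrite AQ ?groupV.
  have defx : x = c ((c^-1)%g x) by rewrite permKV.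
  move: ((c^-1)%g x) Qy defx => y Qy ->; rewrite permJ bQ //.
  have [/setIP[_ Py] Qyv] : y \in Q /\ y ^ v \in Q by rewrite -bQ ?AQ.
  by rewrite -!cE // (hom_conjg Fc') // JP.
have pN : p.-group Ng.
  (* Take b in N of prime order q. Its power d = b^|P| is trivial on Q because v^|P| = 1. Each x^-1
     d(x) lies in Q and is fixed by d, so d^n sends x to x (x^-1 d(x))^n and d^|P| = 1. Thus q
     divides |P|^2, which forces q = p. *)
  apply/pgroupP=> q pr_q /(Cauchy pr_q)[b Nb ob].
  have /NP[AFb bR [v Pv bQ]] := Nb.
  have pP : p.-group P := pgroupS sPS pS.
  have iter_bQ n : {in Q, forall x, (b ^+ n)%g x = x ^ (v ^+ n)}.
    elim: n => [|n IHn] x Qx; first by rewrite perm1 conjg1.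
    have AFn : (b ^+ n)%g \in AutF F R by rewrite groupX.
    by rewrite expgSr permM bQ ?AQ // IHn // expgSr conjgM.
  pose d := (b ^+ #|P|)%g.
  have /NP[AFd dR _] : d \in Ng by rewrite groupX.
  have dQ : {in Q, forall x, d x = x}.
    by move=> x Qx; rewrite iter_bQ // (expg_cardG Pv) conjg1.
  have dM := hom_morph (AutF_hom sRS AFd).
  have iter_d n : {in R, forall x, (d ^+ n)%g x = x * (x^-1 * d x) ^+ n}.
    elim: n => [|n IHn] x Rx; first by rewrite perm1 mulg1.
    have Qx : x^-1 * d x \in Q by rewrite in_setI dR // groupM ?groupV ?AR.
    rewrite expgSr permM IHn // dM ?groupX //; last by case/setIP: Qx.
    by rewrite (dQ (_ ^+ n)) ?groupX // expgS mulgA mulKVg.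
  have: (b ^+ (#|P| * #|P|))%g = 1.
    rewrite expgM -/d; apply: (@eq_Aut _ R); rewrite ?group1 //.
      by rewrite (@AutF_Aut _ _ F) // groupX.
    by move=> x Rx; rewrite iter_d // (expg_cardG (dR x Rx)) mulg1 perm1.
  move/eqP; rewrite -order_dvdn ob Euclid_dvdM // orbb.
  exact: (pgroupP pP).
have sNS : Ng \subset Aut_by S R.
  apply: subset_trans (pcore_sub_Hall (Sylow_Aut_by satF fnR)).
  by rewrite pcore_max // /normal sNG.
have Nu_N : conj_aut R u \in Ng.
  apply/NP; split=> [|x Rx|]; first exact: conj_aut_AutF.
    (* The commutator x^-1 x^u is the inverse of u^-1 u^x, which lies in P because x normalizes
       P. *)
    rewrite norm_conj_autE // -/(commg x u) -groupV invg_comm.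
    have /normal_norm nPS := strongly_closed_normal scP.
    rewrite commgEl groupM ?groupV // memJ_norm ?groupV //.
    exact: (subsetP nPS _ (subsetP sRS _ Rx)).
  by exists u => // x /setIP[Rx _]; rewrite norm_conj_autE.
apply: (mem_Nphi AFa) => //; apply: (subsetP sNS).
by rewrite memJ_norm ?(subsetP nNG).
Qed.

Lemma fs_normal_of_no_essential : fs_normal F P.
Proof.
split; first exact: strongly_closed_normal scP.
move=> A B f Ff; have [g [Fg gE]] := extends_any (hom_widen Ff).
have FAB := hom_join scP Ff Fg gE; exists g; split=> //.
by apply: (strongly_closed_im scP _ FAB); rewrite joing_subl.
Qed.

End Essential.

(** * Normal subgroups admit no essential subgroups; the equivalence *)

Lemma fs_normal_no_essential (gT : finGroupType) (p : nat) (S P Q : {group gT})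
    (F : fusion_system S) :
  fs_normal F P -> ~ essential_wrt F p P Q.
Proof.
move=> [nPS extF] [ltQP _ [sQS _] [H [[_ ntD _] ltHG [x Gx sDH] disj]]].
have nDG : OutF F Q \subset 'N(Out_by P Q).
  apply: quotient_norms; apply/subsetP=> a AFa.
  rewrite inE; apply/subsetP=> _ /imsetP[_ /Aut_byP[u /setIP[Pu Nu] ->] ->].
  (* The extension of [a] to PQ preserves P, so the conjugate under [a] of c_u is c_f(u) with f(u)
     again in P. *)
  have [f [Ff fE fP]] := extF _ _ _ (AutF_hom sQS AFa).
  have PQu : u \in (P <*> Q)%G by rewrite (subsetP (joing_subl P Q)).
  have [Nfu ->] := conj_aut_extension AFa Ff (joing_subr P Q) fE PQu Nu.
  by apply/Aut_byP; exists (f u); rewrite // in_setI Nfu andbT -fP imset_f.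
have DJ g : g \in OutF F Q -> Out_by P Q :^ g = Out_by P Q.
  by move=> Gg; apply/normP/(subsetP nDG).
have [_ [g Gg notHg]] := properP ltHG.
(* The embedding condition fails for U = Out_P(Q) itself: being normalized by Out_F(Q), it lies in
   both H and H^g. *)
have := disj g _ (Out_by P Q) 1 (subxx _) ntD (group1 _).
rewrite in_setD notHg Gg => /(_ isT)/negP[].
rewrite conjsg1 subsetI; rewrite DJ // in sDH.
by have := conjSg (Out_by P Q) H g; rewrite DJ // sDH => ->.
Qed.

Theorem theorem2 (gT : finGroupType) (p : nat) (S P : {group gT})
    (F : fusion_system S) :
  prime p -> p.-group S -> saturated F p -> strongly_closed F P ->
  (fs_normal F P <-> ~ exists Q : {group gT}, essential_wrt F p P Q).
Proof.
move=> _ pS satF scP; split=> [nP [Q] | noess].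
  exact: fs_normal_no_essential.
exact: fs_normal_of_no_essential noess.
Qed.
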